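(* Let $(Y,d)$ be the infinite necklace tree defined as follows. For each natural number $n\ge 2$ let $Y_n$ be the star with $n$ leaves, i.e. the tree with $n+1$ vertices consisting of an internal node $r_n$ adjacent to each of $n$ leaves (the $Y_n$ being taken pairwise disjoint). Let $Y$ be the infinite tree obtained from the disjoint union of all $Y_n$, $n\ge2$, by adding, for each $n\ge 2$, an edge joining $r_n$ to $r_{n+1}$, and let $d$ be the ordinary path metric on $Y$ (all edges have length $1$). Then $(Y,d)$ has strict $1$-negative type but does not have $p$-negative type for any $p>1$. Moreover, the $1$-negative type gap $\Gamma_Y$ equals $0$.
   Context: For $p\ge 0$, a metric space $(X,d)$ has $p$-negative type if for all $n\ge2$, all finite subsets $\{x_1,\dots,x_n\}\subseteq X$ (distinct points), and all real $\eta_1,\dots,\eta_n$ with $\eta_1+\cdots+\eta_n=0$, one has $\sum_{1\le i,j\le n}d(x_i,x_j)^p\eta_i\eta_j\le 0$. It has strict $p$-negative type if moreover this inequality is strict whenever $(\eta_1,\dots,\eta_n)\ne(0,\dots,0)$. For $q,t\in\mathbb{N}=\{1,2,\dots\}$, a normalized $(q,t)$-simplex $D(\vec\omega)=[a_j(m_j);b_i(n_i)]_{q,t}$ in $X$ consists of $q+t$ pairwise distinct points $a_1,\dots,a_q,b_1,\dots,b_t\in X$ together with positive weights $\vec\omega=(m_1,\dots,m_q,n_1,\dots,n_t)$ satisfying $\sum_j m_j=1=\sum_i n_i$. Its simplex gap is $$\gamma_D(\vec\omega)=\sum_{j=1}^{q}\sum_{i=1}^{t} m_jn_i\,d(a_j,b_i)-\sum_{j_1<j_2}m_{j_1}m_{j_2}\,d(a_{j_1},a_{j_2})-\sum_{i_1<i_2}n_{i_1}n_{i_2}\,d(b_{i_1},b_{i_2}).$$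 The $1$-negative type gap of $(X,d)$ is $\Gamma_X=\inf\gamma_D(\vec\omega)$ over all $q,t$ and all normalized $(q,t)$-simplexes in $X$. *)

(* Defs.v *)
From HB Require Import structures.
From mathcomp Require Import all_boot all_order all_algebra.
From mathcomp Require Import all_classical all_reals all_analysis.

Set Implicit Arguments.
Unset Strict Implicit.
Unset Printing Implicit Defensive.

Import Order.TTheory GRing.Theory Num.Theory.

Local Open Scope classical_set_scope.
Local Open Scope ring_scope.

(* [powR] sets 0 `^ p = 0 for p != 0 and 0 `^ 0 = 1. *)
Definition negative_type (R : realType) (p : R) (X : metricType R) : Prop :=
  forall (n : nat) (x : 'I_n -> X) (eta : 'I_n -> R),
    (2 <= n)%N -> injective x -> \sum_(i < n) eta i = 0 ->
    \sum_(i < n) \sum_(j < n) mdist (x i) (x j) `^ p * eta i * eta j <= 0.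

Definition strict_negative_type (R : realType) (p : R) (X : metricType R) :
    Prop :=
  negative_type p X /\
  forall (n : nat) (x : 'I_n -> X) (eta : 'I_n -> R),
    (2 <= n)%N -> injective x -> \sum_(i < n) eta i = 0 ->
    (exists i, eta i != 0) ->
    \sum_(i < n) \sum_(j < n) mdist (x i) (x j) `^ p * eta i * eta j < 0.

Record normalized_simplex (R : realType) (X : metricType R) (q t : nat) :=
  NormalizedSimplex {
    simplex_a : 'I_q -> X;
    simplex_b : 'I_t -> X;
    simplex_m : 'I_q -> R;
    simplex_n : 'I_t -> R;
    simplex_a_inj : injective simplex_a;
    simplex_b_inj : injective simplex_b;
    simplex_ab_neq : forall j i, simplex_a j <> simplex_b i;
    simplex_m_gt0 : forall j, 0 < simplex_m j;
    simplex_n_gt0 : forall i, 0 < simplex_n i;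
    simplex_m_sum : \sum_(j < q) simplex_m j = 1;
    simplex_n_sum : \sum_(i < t) simplex_n i = 1
  }.

Definition simplex_gap (R : realType) (X : metricType R) (q t : nat)
    (D : normalized_simplex X q t) : R :=
  let a := simplex_a D in let b := simplex_b D in
  let m := simplex_m D in let n := simplex_n D in
  \sum_(j < q) \sum_(i < t) m j * n i * mdist (a j) (b i)
  - \sum_(j1 < q) \sum_(j2 < q | (j1 < j2)%N)
      m j1 * m j2 * mdist (a j1) (a j2)
  - \sum_(i1 < t) \sum_(i2 < t | (i1 < i2)%N)
      n i1 * n i2 * mdist (b i1) (b i2).

(* The infimum is taken in \bar R: the real-valued [inf] is 0 by convention on
   sets that are empty or unbounded below. *)
Definition negative_type_gap (R : realType) (X : metricType R) : \bar R :=
  ereal_inf [set g : \bar R | exists q t : nat, [/\ (1 <= q)%N, (1 <= t)%N &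
    exists D : normalized_simplex X q t, g = (simplex_gap D)%:E]].

Definition graph_connected (V : eqType) (e : rel V) : Prop :=
  forall x y : V, exists2 s, path e x s & last x s = y.

(* Junk value 0 when no walk joins x to y. *)
Definition path_dist (R : realType) (V : eqType) (e : rel V) (x y : V) : R :=
  inf [set (size s)%:R | s in [set s | path e x s /\ last x s = y]].

Section PathMetric.
Variables (R : realType) (V : eqType) (e : rel V).
Hypotheses (e_sym : symmetric e) (e_conn : graph_connected e).

Lemma path_dist_le (x : V) (s : seq V) :
  path e x s -> path_dist R e x (last x s) <= (size s)%:R.
Proof.
move=> xs; apply: ge_inf; last by exists s.
by exists 0 => _ [s' _ <-]; rewrite ler0n.
Qed.

Lemma path_dist_attained (x y : V) :
  exists s, [/\ path e x s, last x s = y & path_dist R e x y = (size s)%:R].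
Proof.
pose W k := `[< exists s, [/\ path e x s, last x s = y & size s = k] >].
have exW : exists k, W k.
  by have [s xs ys] := e_conn x y; exists (size s); apply/asboolP; exists s.
have [k /asboolP[s [xs ys sk]] kmin] := ex_minnP exW.
exists s; split=> //; apply/eqP; rewrite eq_le; apply/andP; split.
  by rewrite -ys path_dist_le.
apply: lb_le_inf; first by exists (size s)%:R, s.
move=> _ [s' [xs' ys'] <-]; rewrite ler_nat sk; apply: kmin.
by apply/asboolP; exists s'.
Qed.

Lemma path_distxx (x : V) : path_dist R e x x = 0.
Proof.
have [s [_ _ ds]] := path_dist_attained x x.
apply/eqP; rewrite eq_le {2}ds ler0n andbT.
exact: (@path_dist_le x [::]).
Qed.

Lemma path_dist_positivity (x y : V) : path_dist R e x y = 0 -> x = y.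
Proof.
have [s [_ <- ->]] := path_dist_attained x y.
by move/eqP; rewrite pnatr_eq0 size_eq0 => /eqP ->.
Qed.

Lemma path_dist_sym (x y : V) : path_dist R e x y = path_dist R e y x.
Proof.
suff le_sym u v : path_dist R e u v <= path_dist R e v u.
  by apply/eqP; rewrite eq_le !le_sym.
have [s [vs us ->]] := path_dist_attained v u.
have vE : last u (rev (belast v s)) = v.
  by rewrite -us; case: s {vs us} => //= z s; rewrite rev_cons last_rcons.
have := @path_dist_le u (rev (belast v s)).
rewrite vE size_rev size_belast; apply.
by rewrite -us rev_path; apply: sub_path vs => a b; rewrite e_sym.
Qed.

Lemma path_dist_triangle (y x z : V) :
  path_dist R e x z <= path_dist R e x y + path_dist R e y z.
Proof.
have [s [xs ys ->]] := path_dist_attained x y.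
have [s' [ys' zs' ->]] := path_dist_attained y z.
rewrite -natrD -size_cat -zs' -ys -last_cat; apply: path_dist_le.
by rewrite cat_path xs ys.
Qed.

End PathMetric.

(* None is the internal node, Some i the i-th leaf. *)
Definition star_edge (n : nat) : rel (option 'I_n) :=
  fun u v => isSome u (+) isSome v.

(* The component of index k is the star with k + 2 leaves. *)
Definition necklace_vertex := {k : nat & option 'I_k.+2}.

Definition necklace_edge : rel necklace_vertex := fun x y =>
  (tag x == tag y) && star_edge (tagged x) (tagged_as x y)
  || [&& tagged x == None, tagged y == None &
         (tag y == (tag x).+1) || (tag x == (tag y).+1)].

Lemma necklace_edge_sym : symmetric necklace_edge.
Proof.
move=> [k u] [l v]; rewrite /necklace_edge /=; congr (_ || _).
  rewrite [l == k]eq_sym; case: eqP => //= kl; case: l / kl v => v.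
  by rewrite !tagged_asE /star_edge addbC.
by rewrite andbCA [X in [&& _, _ & X]]orbC.
Qed.

Lemma necklace_connected : graph_connected necklace_edge.
Proof.
pose star_at (k : nat) : Type := option 'I_k.+2.
pose hub (k : nat) : necklace_vertex := existT star_at k None.
have rev_walk x y : (exists2 s, path necklace_edge x s & last x s = y) ->
    exists2 s, path necklace_edge y s & last y s = x.
  case=> s xs <-; exists (rev (belast x s)).
    by rewrite rev_path; apply: sub_path xs => a b; rewrite necklace_edge_sym.
  by case: s {xs} => //= z s; rewrite rev_cons last_rcons.
have cat_walk x y z : (exists2 s, path necklace_edge x s & last x s = y) ->
    (exists2 s, path necklace_edge y s & last y s = z) ->
    exists2 s, path necklace_edge x s & last x s = z.
  case=> s xs ys [s' ys' zs']; exists (s ++ s'); last by rewrite last_cat ys.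
  by rewrite cat_path xs ys.
have hub_walk k :
    exists2 s, path necklace_edge (hub 0%N) s & last (hub 0%N) s = hub k.
  elim: k => [|k IHk]; first by exists [::].
  apply: cat_walk IHk _; exists [:: hub k.+1] => //=.
  by rewrite andbT /necklace_edge /= !eqxx /= orbT.
have base_walk x :
    exists2 s, path necklace_edge (hub 0%N) s & last (hub 0%N) s = x.
  case: x => k u; apply: cat_walk (hub_walk k) _.
  case: u => [i|]; last by exists [::].
  exists [:: existT star_at k (Some i)] => //=.
  by rewrite andbT /necklace_edge /= eqxx tagged_asE.
by move=> x y; apply: cat_walk (base_walk y); apply: rev_walk.
Qed.

(* An alias of [necklace_vertex] carrying R, so that the R-valued metric is
   canonically attached to it. *)
Definition necklace (R : realType) : Type := necklace_vertex.

HB.instance Definition _ (R : realType) := Choice.on (necklace R).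

HB.instance Definition _ (R : realType) :=
  @isMetric.Build R (necklace R) (path_dist R necklace_edge)
    (path_distxx R necklace_connected)
    (path_dist_positivity (R := R) necklace_connected)
    (path_dist_sym R necklace_edge_sym necklace_connected)
    (path_dist_triangle R necklace_connected).

(* Main.v *)
Require Import Defs.
From HB Require Import structures.
From mathcomp Require Import all_boot all_order all_algebra.
From mathcomp Require Import all_classical all_reals all_analysis.
From mathcomp Require Import zify ring lra.

(** The whole proof rests on the explicit metric of the necklace: two distinct
    vertices are at distance |k - l| + h + h', where k and l are the indices of
    their stars and h, h' are 1 for a leaf and 0 for a hub
    ([path_dist_necklace]).

    Each edge of the spine separates the indices <= m from those > m, and
    |k - l| counts the separations of k from l ([tag_dist_cuts]).  A separation
    contributes minus twice a square to the quadratic form on weights of sum 0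
    ([sum_sqr_diff]), and so does the pendant edge of each leaf.  The form is
    therefore -2 times a sum of squares, one for each edge
    ([necklace_form]).  If it vanishes, every leaf has weight 0 and every
    initial segment of stars has total weight 0; taking differences, each hub
    has weight 0 too.  This is strictness for exponent 1.

    The other two claims come from the stars alone, which become as large as
    one likes.  In the star with n leaves, weight n on the hub and -1 on each
    leaf give the form n ((2 ^ p - 2) n - 2 ^ p), which is positive for large n
    as soon as p > 1.  The same weights divided by n make up a simplex of gap
    1 / n ([star_simplex]).  No gap is negative, since the form on the vertices
    of a simplex, with opposite signs on its two sides, is -2 times its gap
    ([simplex_form]); so the infimum of the gaps is 0. *)

Set Implicit Arguments.
Unset Strict Implicit.
Unset Printing Implicit Defensive.

Import Order.TTheory GRing.Theory Num.Theory.

Local Open Scope ring_scope.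

(** * The metric of the necklace *)

Definition hub (k : nat) : necklace_vertex :=
  existT (fun k => option 'I_k.+2) k None.

Definition leaf (k : nat) (i : 'I_k.+2) : necklace_vertex :=
  existT (fun k => option 'I_k.+2) k (Some i).

Definition is_leaf (x : necklace_vertex) : bool := isSome (tagged x).

(** Truncated subtraction makes one of the two terms 0: this is |k - l|. *)
Definition tag_dist (k l : nat) : nat := (k - l + (l - k))%N.

Definition necklace_dist (x y : necklace_vertex) : nat :=
  if x == y then 0%N else (is_leaf x + is_leaf y + tag_dist (tag x) (tag y))%N.

(** Every edge joins a hub to one of its leaves or to a neighbouring hub. *)
Lemma necklace_edge_unit x y : necklace_edge x y ->
  (is_leaf x + is_leaf y + tag_dist (tag x) (tag y) = 1)%N.
Proof.
case: x y => [k u] [l v]; rewrite /necklace_edge /is_leaf /tag_dist /=.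
case/orP => [/andP[/eqP kl]|].
  case: l / kl v => v; rewrite tagged_asE /star_edge subnn.
  by case: u v => [?|] [?|].
by case/and3P => /eqP -> /eqP -> /orP[] /eqP -> /=; lia.
Qed.

(** Moving one end of a pair along an edge changes [necklace_dist] by at most
    1, so no walk can be shorter than it. *)
Lemma necklace_dist_le_size s x :
  path necklace_edge x s -> (necklace_dist x (last x s) <= size s)%N.
Proof.
elim: s x => [|y s IHs] x /=; first by rewrite /necklace_dist eqxx.
case/andP => /necklace_edge_unit xy /IHs.
rewrite /necklace_dist; case: (x == _) => //.
case: eqP => [<- | _]; first by rewrite xy.
by move: xy; rewrite /tag_dist; lia.
Qed.

Section NecklaceMetric.
Variable R : realType.

Local Notation d := (path_dist R necklace_edge).
Local Notation d_triangle := (path_dist_triangle R necklace_connected).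
Local Notation d_sym := (path_dist_sym R necklace_edge_sym necklace_connected).

Lemma path_dist_edge x y : necklace_edge x y -> d x y <= 1.
Proof.
by move=> xy; apply: (@path_dist_le R _ _ x [:: y]); rewrite /= xy.
Qed.

Lemma path_dist_to_hub x : d x (hub (tag x)) <= (is_leaf x)%:R.
Proof.
case: x => k [i|] /=; last by rewrite path_distxx //; exact: necklace_connected.
by apply: path_dist_edge; rewrite /necklace_edge /= eqxx tagged_asE.
Qed.

Lemma path_dist_hub_add k m : d (hub k) (hub (k + m)) <= m%:R.
Proof.
elim: m => [|m IHm].
  by rewrite addn0 path_distxx //; exact: necklace_connected.
apply: le_trans (d_triangle (hub (k + m)) _ _) _.
rewrite -addn1 natrD addnA lerD // addn1.
by apply: path_dist_edge; rewrite /necklace_edge /= !eqxx /= orbT.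
Qed.

Lemma path_dist_hubs k l : d (hub k) (hub l) <= (tag_dist k l)%:R.
Proof.
wlog kl : k l / (k <= l)%N => [hw|].
  case: (leqP k l) => [/hw // | /ltnW /hw].
  by rewrite d_sym /tag_dist addnC.
have -> : tag_dist k l = (l - k)%N by rewrite /tag_dist; lia.
by have := path_dist_hub_add k (l - k); rewrite subnKC.
Qed.

(** The upper bound is the walk through the two hubs, by the triangle
    inequality. *)
Lemma path_dist_necklace x y : d x y = (necklace_dist x y)%:R.
Proof.
apply/eqP; rewrite eq_le; apply/andP; split; last first.
  have [s [xs <- ->]] := path_dist_attained R necklace_connected x y.
  by rewrite ler_nat necklace_dist_le_size.
rewrite /necklace_dist; case: eqP => [-> | _].
  by rewrite path_distxx //; exact: necklace_connected.
apply: le_trans (d_triangle (hub (tag x)) _ _) _.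
rewrite -addnA natrD lerD ?path_dist_to_hub // addnC natrD.
apply: le_trans (d_triangle (hub (tag y)) _ _) _.
by rewrite lerD ?path_dist_hubs // d_sym path_dist_to_hub.
Qed.

Lemma mdist_necklace (x y : necklace R) : mdist x y = (necklace_dist x y)%:R.
Proof. exact: path_dist_necklace. Qed.

Lemma mdist_hub_leaf k (i : 'I_k.+2) :
  mdist (hub k : necklace R) (leaf i) = 1.
Proof.
rewrite mdist_necklace /necklace_dist /tag_dist /= subnn.
by rewrite -tag_eqE /tag_eq /= eqxx tagged_asE.
Qed.

Lemma mdist_leaves k (i j : 'I_k.+2) :
  mdist (leaf i : necklace R) (leaf j) = if i == j then 0 else 2.
Proof.
rewrite mdist_necklace /necklace_dist /tag_dist /= subnn.
rewrite -tag_eqE /tag_eq /= eqxx tagged_asE.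
by rewrite (inj_eq Some_inj); case: eqP.
Qed.

Lemma leaf_inj k : injective (@leaf k).
Proof.
move=> i j ij; have := mdist_leaves i j; rewrite ij mdistxx; case: eqP => // _.
by move/eqP; rewrite eq_sym pnatr_eq0.
Qed.

Lemma leaf_neq_hub k (i : 'I_k.+2) : hub k <> leaf i.
Proof. by move/(congr1 is_leaf). Qed.

End NecklaceMetric.

(** * Finite sums *)

Lemma sum_ord_const (R : pzRingType) n (a : R) : \sum_(i < n) a = n%:R * a.
Proof. by rewrite sumr_const card_ord mulr_natl. Qed.

Lemma sum_offdiag (R : pzRingType) n (a : R) (i : 'I_n.+1) :
  \sum_j (if i == j then 0 else a) = n%:R * a.
Proof.
rewrite (bigD1 i) //= eqxx add0r.
under eq_bigr => j ji do rewrite eq_sym (negbTE ji).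
by rewrite sumr_const cardC1 card_ord mulr_natl.
Qed.

Lemma sum_sym_pairs (R : pzRingType) n (F : 'I_n -> 'I_n -> R) :
  (forall i j, F i j = F j i) -> (forall i, F i i = 0) ->
  \sum_i \sum_j F i j = 2 * \sum_(i < n) \sum_(j < n | (i < j)%N) F i j.
Proof.
move=> Fsym Fdiag.
rewrite mulr_natl mulr2n [X in _ + X](exchange_big_dep xpredT) //=.
rewrite -big_split /=.
apply: eq_bigr => i _.
rewrite (bigID (fun j : 'I_n => (i < j)%N)) /=; congr (_ + _).
rewrite (bigD1 i) /= ?ltnn // Fdiag add0r.
apply: eq_big => [j|j _]; last by rewrite Fsym.
by rewrite -leqNgt andbC ltn_neqAle.
Qed.

(** Once the square is expanded, f i ^+ 2 and f j ^+ 2 both come with a factor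
    \sum_i eta i, so only the cross term is left. *)
Lemma sum_sqr_diff (R : comNzRingType) (I : finType) (f eta : I -> R) :
  \sum_i eta i = 0 ->
  \sum_i \sum_j (f i - f j) ^+ 2 * eta i * eta j
    = - 2 * (\sum_i f i * eta i) ^+ 2.
Proof.
move=> eta0.
transitivity (\sum_i \sum_j (f i ^+ 2 * eta i * eta j
    + eta i * (f j ^+ 2 * eta j) - 2 * (f i * eta i) * (f j * eta j))).
  by apply: eq_bigr => i _; apply: eq_bigr => j _; ring.
under eq_bigr do rewrite !big_split /= sumrN -!mulr_sumr eta0 mulr0 add0r.
by rewrite sumrB -!mulr_suml eta0 mul0r -mulr_sumr; ring.
Qed.

(** * The quadratic form of the necklace *)

(** Only the cuts m with min k l <= m < max k l separate k from l. *)
Lemma tag_dist_cuts (R : comNzRingType) M k l : (k <= M)%N -> (l <= M)%N ->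
  (tag_dist k l)%:R = \sum_(m < M) ((k <= m)%N%:R - (l <= m)%N%:R) ^+ 2 :> R.
Proof.
move=> kM lM.
transitivity (\sum_(m < M) ((k <= m) != (l <= m))%N%:R : R); last first.
  by apply: eq_bigr => m _; do 2!case: (_ <= _)%N => /=; ring.
rewrite -natr_sum; congr (_%:R).
(* Truncating at M gives an equation that holds for all M. *)
transitivity (tag_dist (minn k M) (minn l M)).
  by rewrite (minn_idPl kM) (minn_idPl lM).
elim: (M) => [|m IHm]; first by rewrite big_ord0 !minn0.
rewrite big_ord_recr /= -IHm /tag_dist.
by case: (leqP k m); case: (leqP l m) => /=; lia.
Qed.

Section NegativeType.
Variable R : realType.

(** The squares are indexed by the edges: the spine edges m < M first, then the
    pendant edges.  The height terms h i + h j cancel because the weights sum to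
    0, except on the diagonal, where the distance is 0 instead of 2 h i. *)
Lemma necklace_form n (x : 'I_n -> necklace R) (eta : 'I_n -> R) (M : nat) :
  injective x -> \sum_i eta i = 0 -> (forall i, tag (x i) <= M)%N ->
  \sum_i \sum_j mdist (x i) (x j) `^ 1 * eta i * eta j
    = - 2 * (\sum_(m < M) (\sum_i (tag (x i) <= m)%N%:R * eta i) ^+ 2
             + \sum_i (is_leaf (x i))%:R * eta i ^+ 2).
Proof.
move=> x_inj eta0 xM.
pose h i : R := (is_leaf (x i))%:R.
transitivity (\sum_i \sum_j (
    \sum_(m < M) ((tag (x i) <= m)%N%:R - (tag (x j) <= m)%N%:R) ^+ 2
                  * eta i * eta j
    + (h i * eta i * eta j + eta i * (h j * eta j)
       - (if j == i then 2 * h i * eta i ^+ 2 else 0)))).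
  apply: eq_bigr => i _; apply: eq_bigr => j _.
  rewrite powRr1 ?mdist_ge0 // -!mulr_suml -tag_dist_cuts // mdist_necklace.
  rewrite /necklace_dist (inj_eq x_inj) [j == i]eq_sym.
  case: eqP => [-> | _]; first by rewrite /tag_dist subnn; ring.
  by rewrite !natrD /h; ring.
under eq_bigr do rewrite big_split exchange_big /=.
rewrite big_split exchange_big /=.
under eq_bigr do rewrite sum_sqr_diff //.
rewrite -mulr_sumr mulrDr; congr (_ + _).
under eq_bigr do
  rewrite sumrB big_split /= -!mulr_sumr eta0 mulr0 add0r
          -big_mkcond big_pred1_eq.
rewrite sumrB -mulr_suml eta0 mul0r sub0r mulr_sumr -sumrN.
by apply: eq_bigr => i _; rewrite /h; ring.
Qed.

Lemma necklace_strict_negative_type : strict_negative_type 1 (necklace R).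
Proof.
have bound n (x : 'I_n -> necklace R) i : (tag (x i) <= \max_j tag (x j))%N.
  exact: leq_bigmax.
have leaf_ge0 n (x : 'I_n -> necklace R) (eta : 'I_n -> R) i :
    0 <= (is_leaf (x i))%:R * eta i ^+ 2.
  by rewrite mulr_ge0 ?sqr_ge0.
have npos n (x : 'I_n -> necklace R) eta : injective x -> \sum_i eta i = 0 ->
    \sum_i \sum_j mdist (x i) (x j) `^ 1 * eta i * eta j <= 0.
  move=> x_inj eta0; rewrite (necklace_form x_inj eta0 (bound _ _)).
  rewrite mulNr oppr_le0 mulr_ge0 // addr_ge0 //.
    by apply: sumr_ge0 => m _; rewrite sqr_ge0.
  by apply: sumr_ge0.
split=> [n x eta _|n x eta _ x_inj eta0 [i0 /negP etai0]]; first exact: npos.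
rewrite lt_neqAle npos // andbT; apply/eqP.
(* One more than the largest index, so that there is a cut above every star. *)
pose M := (\max_j tag (x j)).+1.
have xM i : (tag (x i) < M)%N by rewrite ltnS bound.
rewrite (@necklace_form _ _ _ M) // => [/eqP|i]; last exact: ltnW.
rewrite mulf_eq0 oppr_eq0 pnatr_eq0 /= paddr_eq0; first last.
- by apply: sumr_ge0.
- by apply: sumr_ge0 => m _; rewrite sqr_ge0.
case/andP; rewrite psumr_eq0 => [|m _]; last by rewrite sqr_ge0.
move/allP => cut0; rewrite psumr_eq0 // => /allP leaf0.
have eta_leaf i : is_leaf (x i) -> eta i = 0.
  move=> xi; have := leaf0 i (mem_index_enum _).
  by rewrite xi mul1r sqrf_eq0 => /eqP.
have cutE m : (m < M)%N -> \sum_i (tag (x i) <= m)%N%:R * eta i = 0.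
  move=> mM; have := cut0 (Ordinal mM) (mem_index_enum _).
  by rewrite sqrf_eq0 => /eqP.
have cut_lt m : (m < M)%N -> \sum_i (tag (x i) < m)%N%:R * eta i = 0.
  case: m => [_|m mM]; first by rewrite big1 // => i _; rewrite mul0r.
  by rewrite -[RHS](cutE m) // ltnW.
apply: etai0; apply/eqP.
case xi0: (is_leaf (x i0)); first exact: eta_leaf.
have := cutE _ (xM i0); rewrite -[RHS](cut_lt _ (xM i0)) => /eqP.
(* The difference of the cuts at tag (x i0) and just below it is the weight of
   that star, of which only the hub remains. *)
rewrite -subr_eq0 -sumrB (bigD1 i0) //= leqnn ltnn mul1r mul0r subr0.
rewrite big1 ?addr0 => [|i ii0]; first by move/eqP.
case xi: (is_leaf (x i)); first by rewrite eta_leaf // !mulr0 subrr.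
rewrite -mulrBl leq_eqVlt; case: eqP => [tagE | _]; last by rewrite subrr mul0r.
case/eqP: ii0; apply: x_inj.
move: (x i) (x i0) tagE xi xi0 => [k [?|]] [l [?|]] //=.
by move=> -> _ _.
Qed.

Lemma necklace_not_negative_type (p : R) :
  1 < p -> ~ negative_type p (necklace R).
Proof.
move=> p1 neg.
have p0 : p != 0 by rewrite gt_eqF // (lt_trans ltr01).
have two_p : 2 < 2 `^ p :> R.
  rewrite -[ltLHS]lnK ?posrE // /powR pnatr_eq0 ltr_expR.
  by rewrite ltr_pMl ?ln_gt0 ?ltr1n.
(* The star with k + 2 leaves is large enough for the form to be positive. *)
have [k kP] : exists k : nat, 2 `^ p < (2 `^ p - 2) * k.+2%:R :> R.
  exists (Num.bound (2 `^ p / (2 `^ p - 2))).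
  rewrite mulrC -ltr_pdivrMr ?subr_gt0 //.
  apply: lt_le_trans (archi_boundP _) _; last first.
    by rewrite ler_nat; do 2!apply: leqW.
  by rewrite divr_ge0 ?powR_ge0 // subr_ge0 ltW.
(* The hub has index 0, the leaf j index j + 1. *)
pose x (i : 'I_k.+3) : necklace R :=
  if unlift ord0 i is Some j then leaf j else hub k.
pose eta (i : 'I_k.+3) : R :=
  if unlift ord0 i is None then k.+2%:R else -1.
have x_inj : injective x.
  move=> i j; rewrite /x.
  case: unliftP => [i' ->|->]; case: unliftP => [j' ->|->] //.
  by move/leaf_inj => ->.
have xS (j : 'I_k.+2) : x (lift ord0 j) = leaf j by rewrite /x liftK.
have etaS (j : 'I_k.+2) : eta (lift ord0 j) = -1 by rewrite /eta liftK.
have x0 : x ord0 = hub k by rewrite /x unlift_none.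
have eta_hub : eta ord0 = k.+2%:R by rewrite /eta unlift_none.
have eta0 : \sum_i eta i = 0.
  rewrite big_ord_recl eta_hub; under eq_bigr do rewrite etaS.
  by rewrite sum_ord_const mulrN1 subrr.
have := neg _ x eta isT x_inj eta0; apply/negP; rewrite -ltNge.
rewrite big_ord_recl [X in X + _]big_ord_recl x0 eta_hub mdistxx powR0 //.
rewrite !mul0r add0r.
under eq_bigr do rewrite xS etaS mdist_hub_leaf powR1 mul1r mulrN1.
rewrite sum_ord_const.
under eq_bigr => i _.
  rewrite big_ord_recl x0 eta_hub xS etaS metric_sym mdist_hub_leaf powR1.
  under eq_bigr => j _.
    rewrite xS etaS mdist_leaves -mulrA mulrNN !mulr1.
    rewrite (fun_if (fun d => d `^ p)) powR0 //; over.
  rewrite sum_offdiag; over.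
rewrite sum_ord_const.
have : 0 < k.+2%:R :> R by [].
move: kP; rewrite -[k.+2]addn1 -[k.+1]addn1 !natrD.
(* The goal is the product of the two hypotheses. *)
by nra.
Qed.

End NegativeType.

(** * The negative type gap *)

Section Gap.
Variable R : realType.

(** The weights are those of the simplex, counted negatively on the b side. *)
Lemma simplex_form (X : metricType R) q t (D : normalized_simplex X q t) :
  exists (x : 'I_(q + t) -> X) (eta : 'I_(q + t) -> R),
    [/\ injective x, \sum_i eta i = 0 &
     \sum_i \sum_j mdist (x i) (x j) `^ 1 * eta i * eta j
       = - 2 * simplex_gap D].
Proof.
pose A := simplex_a D; pose B := simplex_b D.
pose m := simplex_m D; pose n := simplex_n D.
pose x (i : 'I_(q + t)) : X :=
  match fintype.split i with inl j => A j | inr j => B j end.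
pose eta (i : 'I_(q + t)) : R :=
  match fintype.split i with inl j => m j | inr j => - n j end.
have xl j : x (lshift t j) = A j by rewrite /x (unsplitK (inl j)).
have xr j : x (rshift q j) = B j by rewrite /x (unsplitK (inr j)).
have el j : eta (lshift t j) = m j by rewrite /eta (unsplitK (inl j)).
have er j : eta (rshift q j) = - n j by rewrite /eta (unsplitK (inr j)).
exists x, eta; split.
- move=> i j; case: (split_ordP i) => i' ->; case: (split_ordP j) => j' ->;
    rewrite ?xl ?xr.
  + by move/simplex_a_inj => ->.
  + by move=> ij; case: (simplex_ab_neq ij).
  + by move=> ij; case: (simplex_ab_neq (esym ij)).
  + by move/simplex_b_inj => ->.
- rewrite big_split_ord /=.
  under eq_bigr do rewrite el.
  under [X in _ + X]eq_bigr do rewrite er.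
  by rewrite sumrN simplex_m_sum simplex_n_sum subrr.
pose Q i j := mdist (x i) (x j) `^ 1 * eta i * eta j.
have aaE : \sum_(i < q) \sum_(j < q) Q (lshift t i) (lshift t j)
    = 2 * \sum_(i < q) \sum_(j < q | (i < j)%N) m i * m j * mdist (A i) (A j).
  rewrite -sum_sym_pairs => [|i j|i]; last by rewrite mdistxx mulr0.
    apply: eq_bigr => i _; apply: eq_bigr => j _.
    by rewrite /Q !xl !el powRr1 ?mdist_ge0 //; ring.
  by rewrite metric_sym [m i * _]mulrC.
have bbE : \sum_(i < t) \sum_(j < t) Q (rshift q i) (rshift q j)
    = 2 * \sum_(i < t) \sum_(j < t | (i < j)%N) n i * n j * mdist (B i) (B j).
  rewrite -sum_sym_pairs => [|i j|i]; last by rewrite mdistxx mulr0.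
    apply: eq_bigr => i _; apply: eq_bigr => j _.
    by rewrite /Q !xr !er powRr1 ?mdist_ge0 //; ring.
  by rewrite metric_sym [n i * _]mulrC.
have abE : \sum_(i < q) \sum_(j < t) Q (lshift t i) (rshift q j)
    = - \sum_(i < q) \sum_(j < t) m i * n j * mdist (A i) (B j).
  rewrite -sumrN; apply: eq_bigr => i _; rewrite -sumrN; apply: eq_bigr => j _.
  by rewrite /Q xl xr el er powRr1 ?mdist_ge0 //; ring.
have baE : \sum_(j < t) \sum_(i < q) Q (rshift q j) (lshift t i)
    = - \sum_(i < q) \sum_(j < t) m i * n j * mdist (A i) (B j).
  rewrite -abE exchange_big; apply: eq_bigr => i _; apply: eq_bigr => j _.
  by rewrite /Q metric_sym mulrAC.
rewrite big_split_ord /=.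
under eq_bigr do rewrite big_split_ord /=.
under [X in _ + X]eq_bigr do rewrite big_split_ord /=.
rewrite !big_split /= aaE abE baE bbE /simplex_gap /= -/A -/B -/m -/n.
by ring.
Qed.

Lemma simplex_gap_ge0 (X : metricType R) q t (D : normalized_simplex X q t) :
  negative_type 1 X -> (1 <= q)%N -> (1 <= t)%N -> 0 <= simplex_gap D.
Proof.
move=> neg q1 t1; have [x [eta [x_inj eta0 formE]]] := simplex_form D.
have := neg _ x eta (leq_add q1 t1) x_inj eta0.
by rewrite formE mulNr oppr_le0 pmulr_rge0.
Qed.

(** The only distances that count are 1 from the hub to each leaf and 2 between
    leaves: for n = k + 2 the gap is 1 - (n - 1) / n. *)
Lemma star_simplex k :
  exists D : normalized_simplex (necklace R) 1 k.+2,
    simplex_gap D = k.+2%:R^-1.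
Proof.
have hub_inj : injective (fun _ : 'I_1 => hub k : necklace R).
  by move=> i j _; rewrite !ord1.
have one_gt0 (_ : 'I_1) : 0 < 1 :> R by [].
have w_gt0 (_ : 'I_k.+2) : 0 < k.+2%:R^-1 :> R by rewrite invr_gt0.
have one_sum : \sum_(j < 1) 1 = 1 :> R by rewrite big_ord1.
have w_sum : \sum_(i < k.+2) k.+2%:R^-1 = 1 :> R.
  by rewrite sum_ord_const divff.
exists (@NormalizedSimplex R (necklace R) 1 k.+2 (fun=> hub k) (@leaf k)
  (fun=> 1) (fun=> k.+2%:R^-1) hub_inj (@leaf_inj R k)
  (fun=> @leaf_neq_hub k) one_gt0 w_gt0 one_sum w_sum).
rewrite /simplex_gap /= big_ord1.
under eq_bigr do rewrite mdist_hub_leaf mul1r mulr1.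
rewrite w_sum [X in _ - X - _]big1 ?subr0 => [|i _]; last first.
  by rewrite big1 // => j; rewrite !ord1.
set S := (X in 1 - X); suff : 2 * S = 2 * (1 - k.+2%:R^-1).
  have two_neq0 : 2 != 0 :> R by rewrite pnatr_eq0.
  by move/(mulfI two_neq0) ->; rewrite subKr.
rewrite -sum_sym_pairs => [|i j|i]; last by rewrite mdistxx mulr0.
  under eq_bigr => i _.
    under eq_bigr do rewrite mdist_leaves.
    rewrite -mulr_sumr sum_offdiag; over.
  rewrite sum_ord_const.
  have -> : k.+1%:R = k.+2%:R - 1 :> R by rewrite -[k.+2]addn1 natrD addrK.
  by field.
by rewrite metric_sym.
Qed.

Lemma necklace_gap0 : negative_type_gap (necklace R) = 0%E.
Proof.
apply/eqP; rewrite eq_le; apply/andP; split; last first.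
  apply: le_ereal_inf_tmp => _ [q [t [q1 t1 [D ->]]]].
  rewrite lee_fin simplex_gap_ge0 //.
  by case: (necklace_strict_negative_type R).
apply/lee_addgt0Pr => e e0; rewrite add0e.
pose k := Num.bound e^-1.
have [D DE] := star_simplex k.
apply: (@le_trans _ _ (simplex_gap D)%:E).
  by apply: ereal_inf_lbound; exists 1%N, k.+2; split=> //; exists D.
rewrite lee_fin DE invf_ple ?posrE //.
apply: le_trans (ltW (archi_boundP _)) _; first by rewrite invr_ge0 ltW.
by rewrite ler_nat; do 2!apply: leqW.
Qed.

End Gap.

Theorem theorem5p7 (R : realType) :
  [/\ strict_negative_type 1 (necklace R),
      (forall p : R, 1 < p -> ~ negative_type p (necklace R)) &
      negative_type_gap (necklace R) = 0%E].
Proof.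
split.
- exact: necklace_strict_negative_type.
- exact: necklace_not_negative_type.
- exact: necklace_gap0.
Qed.
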